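(* Assume the ergodicity assumption holds. Then $1-\beta:=\inf_{x\in\mathbb S,\|x\|_D=1}x^\top D(I-P)x>0$. Assume in addition $|\mathcal S|\ge2$. When $\min_{s\in\mathcal S}|\mathcal A_s|\ne|\mathcal A|$, if $$\underline\pi\le\frac{(1-\beta)\min_{s\in\mathcal S}\nu(s)}{(|\mathcal A|-\min_{s\in\mathcal S}|\mathcal A_s|)\,(8+(1-\beta)\min_{s\in\mathcal S}\nu(s))}$$ and the perturbed policy $\widetilde\pi$ is constructed from $\underline\pi$, then $$\inf_{x\in\mathbb S,\|x\|_{\widetilde D}=1}x^\top\widetilde D(I-P)x\ \ge\ \min\Big\{\frac{27\alpha(\underline\pi)(1-\beta)}{32},\frac{1-\alpha(\underline\pi)(1-\beta)}{8}\Big\},$$ where $\alpha(\underline\pi):=1-(|\mathcal A|-\min_{s\in\mathcal S}|\mathcal A_s|)\underline\pi\ge\frac89$. As a consequence, the equation $\Psi^\top\widetilde D\Psi\theta^*=\Psi^\top\widetilde DP\Psi\theta^*+\Psi^\top\widetilde D(c-\rho^*\mathbf 1)$ has a unique solution $\theta^*\in\mathbb R^d$. Moreover, for any $\theta,\theta'\in\mathbb R^d$ and $\rho\in\mathbb R$, $$\langle g(\theta,\rho)-g(\theta',\rho),\theta-\theta'\rangle\ge\min\Big\{\frac{27\alpha(\underline\pi)(1-\beta)}{32},\frac{1-\alpha(\underline\pi)(1-\beta)}{8}\Big\}\cdot\|\Psi\theta-\Psi\theta'\|_{\widetilde D}^2,$$ where $g(\theta,\rho)=\Psi^\top\widetilde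 D(\Psi\theta-P\Psi\theta-c+\rho\mathbf 1)$.
   Context: Finite MDP with state space $\mathcal S$, action space $\mathcal A$, transition kernel $\mathsf P(s'|s,a)$ and cost vector $c\in\mathbb R^{|\mathcal S||\mathcal A|}$. **Ergodicity assumption:** for every policy $\pi$ the state chain $P_\pi(s,s')=\sum_a\pi(a|s)\mathsf P(s'|s,a)$ is irreducible and aperiodic; $\nu^\pi>0$ is its stationary distribution. Fix a policy $\pi$ (entries $\pi(a|s)$ may be zero). Write $\nu=\nu^\pi$, $P((s,a),(s',a'))=\mathsf P(s'|s,a)\pi(a'|s')$, $D=\mathrm{diag}(\nu(s)\pi(a|s))$, $\rho^*=\sum_{s,a}\nu(s)\pi(a|s)c(s,a)$, $\|x\|_A=\sqrt{x^\top Ax}$, and $\mathbf 1$ the all-ones vector. $\Psi=[\psi_1,\dots,\psi_d]\in\mathbb R^{|\mathcal S||\mathcal A|\times d}$ has linearly independent columns and $\mathbb S=\mathrm{span}\{\psi_1,\dots,\psi_d\}$. Standing assumption: $\mathbb S$ contains no vector $x$ with $x(s,a)=1$ for all $(s,a)$ with $\pi(a|s)>0$. **Perturbed policy.** For a constant $0<\underline\pi<1$ let $\mathcal A_s:=\{a\in\mathcal A:\pi(a|s)>\underline\pi/2\}$ and $$\widetilde\pi(a|s):=\begin{cases}\underline\pi,&a\notin\mathcal A_s\\ \pi(a|s)\cdot\frac{1-(|\mathcal A|-|\mathcal A_s|)\underline\pi}{\sum_{a'\in\mathcal A_s}\pi(a'|s)},&a\in\mathcal A_s.\end{cases}$$ $\widetilde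 D:=\mathrm{diag}(\nu(s)\widetilde\pi(a|s))$. *)

(* Defs.v *)
From HB Require Import structures.
From mathcomp Require Import all_boot all_order all_algebra.
From mathcomp Require Import all_classical all_reals ereal.

Set Implicit Arguments.
Unset Strict Implicit.
Unset Printing Implicit Defensive.

Import Order.TTheory GRing.Theory Num.Theory.
Local Open Scope ring_scope.

(* Vectors of R^(S x A) are column vectors indexed
   by the library enumeration of [S * A]. *)

Definition sa_entry (R : realType) (S A : finType)
    (x : 'cV[R]_#|{: S * A}|) (s : S) (a : A) : R :=
  x (enum_rank (s, a)) 0.

(* [P s a s'] stands for P(s' | s, a). *)
Definition is_kernel (R : realType) (S A : finType) (P : S -> A -> S -> R) : Prop :=
  (forall s a s', 0 <= P s a s') /\ (forall s a, \sum_(s' : S) P s a s' = 1).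

(* [pi s a] stands for pi(a | s). *)
Definition is_policy (R : realType) (S A : finType) (pi : S -> A -> R) : Prop :=
  (forall s a, 0 <= pi s a) /\ (forall s, \sum_(a : A) pi s a = 1).

Definition state_chain (R : realType) (S A : finType)
    (P : S -> A -> S -> R) (pi : S -> A -> R) (s s' : S) : R :=
  \sum_(a : A) pi s a * P s a s'.

Definition chain_step (R : realType) (S : finType) (Q : S -> S -> R) (k : nat)
    (s s' : S) : R :=
  ((\matrix_(i < #|S|, j < #|S|) Q (enum_val i) (enum_val j)) ^+ k)
    (enum_rank s) (enum_rank s').

Definition irreducible_chain (R : realType) (S : finType) (Q : S -> S -> R) : Prop :=
  forall s s', exists k : nat, 0 < chain_step Q k s s'.

(* The gcd of the return times of each state is 1: 1 is their only common
   divisor. *)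
Definition aperiodic_chain (R : realType) (S : finType) (Q : S -> S -> R) : Prop :=
  forall (s : S) (m : nat),
    (forall k : nat, (0 < k)%N -> 0 < chain_step Q k s s -> (m %| k)%N) -> m = 1%N.

Definition is_stationary (R : realType) (S : finType) (Q : S -> S -> R)
    (nu : S -> R) : Prop :=
  [/\ forall s, 0 <= nu s,
      \sum_(s : S) nu s = 1
    & forall s', \sum_(s : S) nu s * Q s s' = nu s'].

Definition ergodic_mdp (R : realType) (S A : finType) (P : S -> A -> S -> R) : Prop :=
  forall pi : S -> A -> R, is_policy pi ->
    irreducible_chain (state_chain P pi) /\ aperiodic_chain (state_chain P pi).

Definition sa_transition (R : realType) (S A : finType)
    (P : S -> A -> S -> R) (pi : S -> A -> R) : 'M[R]_#|{: S * A}| :=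
  \matrix_(i, j)
    let: (s, a) := (enum_val i : S * A) in
    let: (s', a') := (enum_val j : S * A) in
    P s a s' * pi s' a'.

Definition sa_weight (R : realType) (S A : finType)
    (nu : S -> R) (pi : S -> A -> R) : 'M[R]_#|{: S * A}| :=
  diag_mx (\row_i let: (s, a) := (enum_val i : S * A) in nu s * pi s a).

Definition average_cost (R : realType) (S A : finType)
    (nu : S -> R) (pi : S -> A -> R) (c : 'cV[R]_#|{: S * A}|) : R :=
  \sum_(s : S) \sum_(a : A) nu s * pi s a * sa_entry c s a.

Definition inner (R : realType) (n : nat) (x y : 'cV[R]_n) : R := (x^T *m y) 0 0.

Definition wnorm (R : realType) (n : nat) (W : 'M[R]_n) (x : 'cV[R]_n) : R :=
  Num.sqrt ((x^T *m W *m x) 0 0).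

Definition columns (R : realType) (n d : nat) (Psi : 'M[R]_(n, d)) :
    d.-tuple 'cV[R]_n :=
  [tuple col j Psi | j < d].

(* inf of x^T W (I - P) x over x in V with ||x||_W = 1.  [wnorm W] may vanish
   on all of [V], in which case the infimum is over the empty set and is +oo;
   it is a real number otherwise. *)
Definition inf_form (R : realType) (n : nat) (V : {vspace 'cV[R]_n})
    (W P : 'M[R]_n) : \bar R :=
  ereal_inf [set (((x^T *m W *m (1%:M - P) *m x) 0 0)%:E)
            | x in [set x : 'cV[R]_n | x \in V /\ wnorm W x = 1]]%classic.

Definition main_actions (R : realType) (S A : finType)
    (pi : S -> A -> R) (pmin : R) (s : S) : {set A} :=
  [set a | pmin / 2 < pi s a].

Definition perturbed (R : realType) (S A : finType)
    (pi : S -> A -> R) (pmin : R) (s : S) (a : A) : R :=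
  let As := main_actions pi pmin s in
  if a \in As
  then pi s a * ((1 - (#|A|%:R - #|As|%:R) * pmin) / \sum_(a' in As) pi s a')
  else pmin.

(* The initial values #|A| and 1 below are upper bounds of the entries, so
   these are the true minima when [S] is nonempty and [nu] is a probability. *)
Definition min_main_actions (R : realType) (S A : finType)
    (pi : S -> A -> R) (pmin : R) : nat :=
  \big[minn/#|A|]_(s : S) #|main_actions pi pmin s|.

Definition min_prob (R : realType) (S : finType) (nu : S -> R) : R :=
  \big[Num.min/1]_(s : S) nu s.

Definition alpha (R : realType) (S A : finType)
    (pi : S -> A -> R) (pmin : R) : R :=
  1 - (#|A|%:R - (min_main_actions pi pmin)%:R) * pmin.

Definition td_operator (R : realType) (n d : nat) (Psi : 'M[R]_(n, d))
    (W P : 'M[R]_n) (c : 'cV[R]_n) (theta : 'cV[R]_d) (rho : R) : 'cV[R]_d :=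
  Psi^T *m W *m (Psi *m theta - P *m Psi *m theta - c + rho *: const_mx 1).

(* Main.v *)
Require Import Defs.
From HB Require Import structures.
From mathcomp Require Import all_boot all_order all_algebra.
From mathcomp Require Import all_classical all_reals ereal.
From mathcomp Require Import ring lra.
Set Implicit Arguments.
Unset Strict Implicit.
Unset Printing Implicit Defensive.
Import Order.TTheory GRing.Theory Num.Theory.
Local Open Scope ring_scope.

(* If [mu] is stationary for [P] then
   [x^T D (I - P) x = 1/2 sum_ij mu_i P_ij (x_i - x_j)^2], which vanishes only if
   [x] is constant on the support of [mu]; since no nonzero constant lies in the
   span, positivity of the gap [g = 1 - beta] follows by linear algebra.
   Write [Dt = al D + E] with [E >= 0] of total mass [1 - al].  The [al D] part
   contributes at least [g al |x|_D^2], and the cross term of the [E] part is at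
   most [1/2 |x|_E^2 + 1/16 g al |x|_D^2] by AM-GM and the smallness of [pmin].
   Hence the form is at least [min(15 g / 16, 1/2) |x|_Dt^2].  This is positive
   even when the bound of the theorem is not, which happens for [al g >= 1]. *)

(** * Weighted Cauchy-Schwarz and domination of one sum of squares by another *)

(** By Lagrange's identity, the double sum of [w i * w j * (x i * y j - x j * y i) ^+ 2] is twice
    the difference of the two sides. *)
Lemma weighted_cauchy_schwarz (R : realFieldType) (I : finType) (w x y : I -> R) :
  (forall i, 0 <= w i) ->
  (\sum_i w i * x i * y i) ^+ 2 <=
  (\sum_i w i * x i ^+ 2) * (\sum_i w i * y i ^+ 2).
Proof.
move=> w0.
have : 0 <= \sum_i \sum_j w i * w j * (x i * y j - x j * y i) ^+ 2.
  do 2! (apply: sumr_ge0 => ? _).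
  by rewrite mulr_ge0 ?sqr_ge0 // mulr_ge0.
pose X i := w i * x i ^+ 2; pose Y i := w i * y i ^+ 2.
pose Z i := w i * x i * y i.
have -> : \sum_i \sum_j w i * w j * (x i * y j - x j * y i) ^+ 2 =
    \sum_i \sum_j X i * Y j + \sum_i \sum_j Y i * X j
    - 2 * \sum_i \sum_j Z i * Z j.
  rewrite mulr_sumr -big_split -sumrB; apply: eq_bigr => i _ /=.
  rewrite mulr_sumr -big_split -sumrB; apply: eq_bigr => j _ /=.
  by rewrite /X /Y /Z; ring.
rewrite -!big_distrlr /= (mulrC (\sum_i Y i)) -/X -/Y -/Z.
by rewrite expr2; lra.
Qed.

Lemma sqr_mean_le (R : realFieldType) (I : finType) (w x : I -> R) :
  (forall i, 0 <= w i) -> \sum_i w i = 1 ->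
  (\sum_i w i * x i) ^+ 2 <= \sum_i w i * x i ^+ 2.
Proof.
move=> w0 w1; have := weighted_cauchy_schwarz x (fun=> 1) w0.
under eq_bigr do rewrite mulr1.
by under [X in _ * X]eq_bigr do rewrite expr1n mulr1; rewrite w1 mulr1.
Qed.

(* If [L *m z = 0] implies [M *m z = 0] then [M = C *m L]; this replaces a
   compactness argument. *)
Lemma sqnorm_dominated (R : realFieldType) (p q d : nat)
    (L : 'M[R]_(p, d)) (M : 'M[R]_(q, d)) :
  (forall z : 'cV[R]_d, L *m z = 0 -> M *m z = 0) ->
  exists2 k : R, 0 < k & forall z : 'cV[R]_d,
    \sum_i (M *m z) i 0 ^+ 2 <= k * \sum_i (L *m z) i 0 ^+ 2.
Proof.
move=> LM; have /submxP[C MCL] : (M <= L)%MS.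
  (* Inclusion of row spaces is tested on the columns of [cokermx L]; they are killed by [L], so by
     hypothesis also by [M]. *)
  rewrite submxE; apply/eqP/matrixP => i j.
  have := LM (col j (cokermx L)); rewrite !colE (mulmxA L) (mulmxA M) mulmx_coker mul0mx.
  by move=> /(_ erefl); rewrite -colE => /colP/(_ i); rewrite !mxE.
(* The squared Frobenius norm of [C] suffices, by Cauchy-Schwarz on each row; the [1] makes the
   constant strictly positive. *)
exists (1 + \sum_i \sum_k C i k ^+ 2) => [|z].
  by apply: ltr_pwDl => //; do 2! (apply: sumr_ge0 => ? _); apply: sqr_ge0.
have N0 : 0 <= \sum_i (L *m z) i 0 ^+ 2 by apply: sumr_ge0 => ? _; apply: sqr_ge0.
rewrite mulrDl mul1r ler_wpDl // mulr_suml.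
apply: ler_sum => i _; rewrite MCL -mulmxA [(C *m _) i 0]mxE.
have := @weighted_cauchy_schwarz R _ (fun=> 1) (C i) (fun k => (L *m z) k 0)
  (fun=> ler01).
by rewrite /= -!mulr_sumr !mul1r; under eq_bigr do rewrite mul1r.
Qed.

Lemma sum_enum_val (R : nmodType) (T : finType) (F : T -> R) :
  \sum_(i < #|T|) F (enum_val i) = \sum_t F t.
Proof. by rewrite [RHS](reindex _ (onW_bij _ (@enum_val_bij T))). Qed.

(** * Forms weighted by a diagonal matrix, and the Dirichlet identity *)

Section Forms.
Variables (R : realType) (n : nat).
Implicit Types (w mu : 'rV[R]_n) (P : 'M[R]_n) (x y : 'cV[R]_n).

Lemma mx_diag_form w x y :
  (x^T *m diag_mx w *m y) 0 0 = \sum_i w 0 i * x i 0 * y i 0.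
Proof.
rewrite mul_mx_diag mxE; apply: eq_bigr => i _; rewrite !mxE.
by congr (_ * _); apply: mulrC.
Qed.

Lemma sqr_wnorm_diag w x : (forall i, 0 <= w 0 i) ->
  wnorm (diag_mx w) x ^+ 2 = \sum_i w 0 i * x i 0 ^+ 2.
Proof.
move=> w0; rewrite /wnorm mx_diag_form; under eq_bigr do rewrite -mulrA -expr2.
by rewrite sqr_sqrtr // sumr_ge0 // => i _; rewrite mulr_ge0 ?sqr_ge0.
Qed.

Lemma diag_form_split w P x :
  (x^T *m diag_mx w *m (1%:M - P) *m x) 0 0 =
  \sum_i w 0 i * x i 0 ^+ 2 - \sum_i w 0 i * x i 0 * (P *m x) i 0.
Proof.
rewrite -mulmxA mulmxBl mul1mx mulmxBr [LHS]mxE [X in _ + X]mxE !mx_diag_form; congr (_ - _).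
by apply: eq_bigr => i _; rewrite expr2 mulrA.
Qed.

(** When the square is expanded, the [x i] squares collapse by the unit row sums and the [x j]
    squares by stationarity, both to the squared norm of [x] for [mu]. *)
Lemma dirichlet_identity mu P x :
  (forall i, \sum_j P i j = 1) -> (forall j, \sum_i mu 0 i * P i j = mu 0 j) ->
  (x^T *m diag_mx mu *m (1%:M - P) *m x) 0 0 =
  2^-1 * \sum_i \sum_j mu 0 i * P i j * (x i 0 - x j 0) ^+ 2.
Proof.
move=> P1 muP; rewrite diag_form_split.
have E1 : \sum_i \sum_j mu 0 i * P i j * x i 0 ^+ 2 = \sum_i mu 0 i * x i 0 ^+ 2.
  apply: eq_bigr => i _; rewrite -mulr_suml; congr (_ * _).
  by rewrite -mulr_sumr P1 mulr1.
have E2 : \sum_i \sum_j mu 0 i * P i j * x j 0 ^+ 2 = \sum_i mu 0 i * x i 0 ^+ 2.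
  rewrite exchange_big; apply: eq_bigr => j _ /=.
  by rewrite -mulr_suml muP.
have E3 : \sum_i \sum_j mu 0 i * P i j * (x i 0 * x j 0) =
    \sum_i mu 0 i * x i 0 * (P *m x) i 0.
  apply: eq_bigr => i _; rewrite mxE mulr_sumr.
  by apply: eq_bigr => j _; ring.
have -> : \sum_i \sum_j mu 0 i * P i j * (x i 0 - x j 0) ^+ 2 =
    \sum_i \sum_j mu 0 i * P i j * x i 0 ^+ 2
    + \sum_i \sum_j mu 0 i * P i j * x j 0 ^+ 2
    - 2 * \sum_i \sum_j mu 0 i * P i j * (x i 0 * x j 0).
  rewrite mulr_sumr -big_split -sumrB; apply: eq_bigr => i _ /=.
  rewrite mulr_sumr -big_split -sumrB; apply: eq_bigr => j _ /=.
  by ring.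
by rewrite E1 E2 E3; field.
Qed.

(** * Bounds on the Dirichlet form of a stationary chain and on its perturbation *)

Section Stationary.
Variables (P : 'M[R]_n) (mu : 'rV[R]_n).
Hypothesis P0 : forall i j, 0 <= P i j.
Hypothesis P1 : forall i, \sum_j P i j = 1.
Hypothesis mu0 : forall i, 0 <= mu 0 i.
Hypothesis muP : forall j, \sum_i mu 0 i * P i j = mu 0 j.

Lemma dirichlet_ge0 x : 0 <= (x^T *m diag_mx mu *m (1%:M - P) *m x) 0 0.
Proof.
rewrite dirichlet_identity // mulr_ge0 //; do 2! (apply: sumr_ge0 => ? _).
by rewrite mulr_ge0 ?sqr_ge0 // mulr_ge0.
Qed.

(** Follows from [(a - b)^2 <= 2 a^2 + 2 b^2]; it serves to bound the gap by 2. *)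
Lemma dirichlet_le x :
  (x^T *m diag_mx mu *m (1%:M - P) *m x) 0 0 <= 2 * \sum_i mu 0 i * x i 0 ^+ 2.
Proof.
have -> : 2 * \sum_i mu 0 i * x i 0 ^+ 2 = 2^-1 * \sum_i \sum_j
    mu 0 i * P i j * (2 * x i 0 ^+ 2 + 2 * x j 0 ^+ 2).
  transitivity (2^-1 * (\sum_i \sum_j mu 0 i * P i j * (2 * x i 0 ^+ 2)
     + \sum_j \sum_i mu 0 i * P i j * (2 * x j 0 ^+ 2))).
    rewrite -big_split /= [X in _ = X * _]/= !mulr_sumr.
    apply: eq_bigr => i _; rewrite -!mulr_suml muP -mulr_sumr P1.
    by field.
  rewrite [X in _ + X]exchange_big -big_split /=; congr (_ * _).
  apply: eq_bigr => i _; rewrite -big_split /=.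
  by apply: eq_bigr => j _; ring.
rewrite dirichlet_identity // ler_wpM2l //.
apply: ler_sum => i _; apply: ler_sum => j _.
apply: ler_wpM2l; first exact: mulr_ge0.
have := sqr_ge0 (x i 0 + x j 0); rewrite !expr2; lra.
Qed.

(** The matrices [L] and [M] below are chosen so that the squared norm of [L *m z] is twice the
    Dirichlet form at [Psi *m z] and that of [M *m z] is its weighted squared norm. The hypothesis
    then says that the kernel of [L] lies in that of [M]. *)
Lemma dirichlet_coercive (d : nat) (Psi : 'M[R]_(n, d)) :
  (forall z : 'cV[R]_d,
    (forall i j, 0 < mu 0 i * P i j -> (Psi *m z) i 0 = (Psi *m z) j 0) ->
    forall i, 0 < mu 0 i -> (Psi *m z) i 0 = 0) ->
  exists2 k : R, 0 < k & forall z : 'cV[R]_d,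
    k * (\sum_i mu 0 i * (Psi *m z) i 0 ^+ 2) <=
    ((Psi *m z)^T *m diag_mx mu *m (1%:M - P) *m (Psi *m z)) 0 0.
Proof.
move=> Hker.
pose I : finType := ('I_n * 'I_n)%type.
pose L : 'M[R]_(#|I|, d) := \matrix_(k, j)
  (Num.sqrt (mu 0 (enum_val k).1 * P (enum_val k).1 (enum_val k).2) *
    (Psi (enum_val k).1 j - Psi (enum_val k).2 j)).
pose M : 'M[R]_(n, d) := \matrix_(i, j) (Num.sqrt (mu 0 i) * Psi i j).
have LE (z : 'cV[R]_d) k : (L *m z) k 0 =
    Num.sqrt (mu 0 (enum_val k).1 * P (enum_val k).1 (enum_val k).2) *
    ((Psi *m z) (enum_val k).1 0 - (Psi *m z) (enum_val k).2 0).
  rewrite !mxE -sumrB mulr_sumr; apply: eq_bigr => j _; rewrite !mxE.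
  by ring.
have ME (z : 'cV[R]_d) i : (M *m z) i 0 = Num.sqrt (mu 0 i) * (Psi *m z) i 0.
  by rewrite !mxE mulr_sumr; apply: eq_bigr => j _; rewrite !mxE mulrA.
have LM (z : 'cV[R]_d) : L *m z = 0 -> M *m z = 0.
  move=> Lz; apply/colP => i; rewrite ME !mxE.
  have [mui|] := ltP 0 (mu 0 i); last first.
    by move=> /ler0_sqrtr ->; rewrite mul0r.
  have := Hker z _ i mui; rewrite mxE => ->; first by rewrite mulr0.
  move=> {mui}i j ij; have /colP/(_ (enum_rank (i, j))) := Lz.
  rewrite LE enum_rankK /= [RHS]mxE => /eqP; rewrite mulf_eq0 sqrtr_eq0 leNgt ij /=.
  by rewrite subr_eq0 => /eqP.
have [k k0 Hk] := sqnorm_dominated LM.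
exists ((2 * k)^-1) => [|z]; first by rewrite invr_gt0 mulr_gt0.
set x := Psi *m z.
rewrite mulrC ler_pdivrMr ?mulr_gt0 // dirichlet_identity //.
have -> : \sum_i mu 0 i * x i 0 ^+ 2 = \sum_i (M *m z) i 0 ^+ 2.
  by apply: eq_bigr => i _; rewrite ME exprMn sqr_sqrtr.
have -> : \sum_i \sum_j mu 0 i * P i j * (x i 0 - x j 0) ^+ 2 =
   \sum_i (L *m z) i 0 ^+ 2.
  rewrite pair_bigA -sum_enum_val /=.
  apply: eq_bigr => i _; rewrite LE exprMn sqr_sqrtr //; exact: mulr_ge0.
rewrite (le_trans (Hk z)) // le_eqVlt; apply/orP; left; apply/eqP.
by field.
Qed.

(* Write [w = al * mu + e] with [e >= 0].  The hypothesis [m * P i j <= mu j]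
   gives [(P x)_i ^ 2 <= |x|_mu ^ 2 / m], so the cross term of [e] costs at most
   [|x|_e ^ 2 / 2 + (1 - al) * |x|_mu ^ 2 / (2 * m)]. *)
Lemma perturbed_form_ge (w : 'rV[R]_n) (al m g : R) x :
  0 < m -> 0 <= al -> (forall i j, m * P i j <= mu 0 j) ->
  (forall i, al * mu 0 i <= w 0 i) ->
  \sum_i mu 0 i = 1 -> \sum_i w 0 i = 1 ->
  8 * (1 - al) <= m * al * g ->
  g * (\sum_i mu 0 i * x i 0 ^+ 2) <=
    (x^T *m diag_mx mu *m (1%:M - P) *m x) 0 0 ->
  15 / 16 * g * (al * \sum_i mu 0 i * x i 0 ^+ 2) +
    2^-1 * (\sum_i w 0 i * x i 0 ^+ 2 - al * \sum_i mu 0 i * x i 0 ^+ 2) <=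
  (x^T *m diag_mx w *m (1%:M - P) *m x) 0 0.
Proof.
move=> m0 al0 mP muw mu1 w1 hal hg.
set N := \sum_i mu 0 i * x i 0 ^+ 2 in hg *; set X := al * N.
have N0 : 0 <= N by apply: sumr_ge0 => i _; rewrite mulr_ge0 ?sqr_ge0.
pose e i := w 0 i - al * mu 0 i.
have e0 i : 0 <= e i by rewrite subr_ge0.
have e1 : \sum_i e i = 1 - al by rewrite sumrB -mulr_sumr mu1 w1 mulr1.
have Px i : m * (P *m x) i 0 ^+ 2 <= N.
  apply: (@le_trans _ _ (m * \sum_j P i j * x j 0 ^+ 2)).
    by rewrite ler_wpM2l ?(ltW m0) // mxE sqr_mean_le.
  rewrite mulr_sumr; apply: ler_sum => j _.
  by rewrite mulrA ler_wpM2r ?sqr_ge0.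
have cross : \sum_i e i * x i 0 * (P *m x) i 0 <=
    2^-1 * \sum_i e i * x i 0 ^+ 2 + 2^-1 * ((1 - al) * (N / m)).
  rewrite -e1 mulr_suml !mulr_sumr -big_split; apply: ler_sum => i _ /=.
  have {}Px : (P *m x) i 0 ^+ 2 <= N / m by rewrite ler_pdivlMr // mulrC.
  have H : x i 0 * (P *m x) i 0 <= 2^-1 * x i 0 ^+ 2 + 2^-1 * (N / m).
    have := sqr_ge0 (x i 0 - (P *m x) i 0); move: Px; rewrite !expr2; lra.
  have := ler_wpM2l (e0 i) H; rewrite mulrDr !mulrA !(mulrC 2^-1); lra.
have E1 : \sum_i w 0 i * x i 0 ^+ 2 = X + \sum_i e i * x i 0 ^+ 2.
  rewrite /X mulr_sumr -big_split; apply: eq_bigr => i _ /=.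
  by rewrite /e; ring.
have E2 : \sum_i w 0 i * x i 0 * (P *m x) i 0 =
   al * (\sum_i mu 0 i * x i 0 * (P *m x) i 0) +
   \sum_i e i * x i 0 * (P *m x) i 0.
  rewrite mulr_sumr -big_split; apply: eq_bigr => i _ /=.
  by rewrite /e; ring.
move: hg; rewrite !diag_form_split E1 E2 -/N => hg.
(* The smallness of [1 - al] enters here. Half of this quantity, at most [g * X / 16], is taken from
   the [g * X] of the [al * mu] part, which leaves the factor [15 / 16]. *)
have hm : (1 - al) * (N / m) <= 8^-1 * (g * X).
  rewrite mulrA ler_pdivrMr // /X.
  have := ler_wpM2r N0 hal; lra.
have := ler_wpM2l al0 hg; rewrite /X in hm *; lra.
Qed.

End Stationary.
End Forms.

(** * The infimum over unit vectors against a homogeneous inequality *)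

Section InfForm.
Variables (R : realType) (n : nat) (V : {vspace 'cV[R]_n}).
Variables (w : 'rV[R]_n) (P : 'M[R]_n).
Hypothesis w0 : forall i, 0 <= w 0 i.

Lemma inf_form_ge (g : R) :
  (forall x : 'cV[R]_n, x \in V -> g * (\sum_i w 0 i * x i 0 ^+ 2) <=
    (x^T *m diag_mx w *m (1%:M - P) *m x) 0 0) ->
  (g%:E <= inf_form V (diag_mx w) P)%E.
Proof.
move=> H; apply/ereal_infP => _ [x [Vx Nx] <-]; rewrite lee_fin.
by have := H x Vx; rewrite -sqr_wnorm_diag // Nx expr1n mulr1.
Qed.

(** Both sides are homogeneous of degree 2, so a vector of nonzero norm is rescaled to norm 1. A
    vector of zero norm cannot be rescaled: there the left side vanishes and nonnegativity of the
    form concludes. *)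
Lemma inf_form_geP (g : R) :
  (forall x : 'cV[R]_n, 0 <= (x^T *m diag_mx w *m (1%:M - P) *m x) 0 0) ->
  (g%:E <= inf_form V (diag_mx w) P)%E ->
  forall x : 'cV[R]_n, x \in V -> g * (\sum_i w 0 i * x i 0 ^+ 2) <=
    (x^T *m diag_mx w *m (1%:M - P) *m x) 0 0.
Proof.
move=> F0 /ereal_infP Hg x Vx; rewrite -sqr_wnorm_diag //.
have [N0|N0] := eqVneq (wnorm (diag_mx w) x) 0.
  by rewrite N0 expr0n /= mulr0.
have Np : 0 < wnorm (diag_mx w) x by rewrite lt_def N0 sqrtr_ge0.
set r := wnorm _ _ in N0 Np *.
have scale (W : 'M[R]_n) :
    ((r^-1 *: x)^T *m W *m (r^-1 *: x)) 0 0 = (x^T *m W *m x) 0 0 / r ^+ 2.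
  by rewrite [(r^-1 *: x)^T]linearZ /= -!scalemxAl -scalemxAr scalerA mxE -expr2 exprVn mulrC.
rewrite -ler_pdivlMr ?exprn_gt0 // -lee_fin.
rewrite -[_ *m diag_mx w *m _]mulmxA -scale.
apply: Hg; exists (r^-1 *: x); last by rewrite -[_ *m diag_mx w *m _]mulmxA.
split; first exact: memvZ.
rewrite /wnorm scale sqrtrM; last first.
  rewrite mx_diag_form; apply: sumr_ge0 => i _.
  by rewrite -mulrA mulr_ge0 // -expr2 sqr_ge0.
by rewrite -/(wnorm _ _) -/r sqrtrV ?exprn_ge0 ?sqrtr_sqr ?ger0_norm ?mulfV // ltW.
Qed.

End InfForm.

(** * Irreducible chains: invariant functions and stationary distributions *)

Section Chains.
Variables (R : realType) (S : finType) (Q : S -> S -> R).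
Hypothesis Q0 : forall s s', 0 <= Q s s'.
Hypothesis Qirr : irreducible_chain Q.

Let M := \matrix_(i < #|S|, j < #|S|) Q (enum_val i) (enum_val j).

Let M_exp_ge0 k i j : 0 <= (M ^+ k) i j.
Proof.
elim: k i j => [|k IH] i j; first by rewrite expr0 mxE ler0n.
by rewrite exprSr mxE sumr_ge0 // => l _; rewrite mulr_ge0 // mxE.
Qed.

(** A positive entry of [M ^+ k] yields a path of [k] positive transitions, by induction on [k], and
    [f] does not change along it. *)
Lemma irreducible_invariant (T : Type) (f : S -> T) :
  (forall s s', 0 < Q s s' -> f s = f s') -> forall s s', f s = f s'.
Proof.
move=> fQ s s'; have [k] := Qirr s s'; rewrite /chain_step -/M.
rewrite -[in f s](enum_rankK s) -[in f s'](enum_rankK s').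
elim: k (enum_rank s') => [|k IH] j.
  by rewrite expr0 mxE; case: eqVneq => [->|]; rewrite ?ltxx.
rewrite exprSr mxE => Mp.
have [l /andP[]] : exists l, (0 < (M ^+ k) (enum_rank s) l) && (0 < M l j).
  apply/existsP; apply: contraTT Mp => /existsPn H; rewrite -leNgt.
  apply: sumr_le0 => l _; have := H l.
  rewrite negb_and -!leNgt => /orP[] H'.
    by rewrite mulr_le0_ge0 // mxE.
  by rewrite mulr_ge0_le0.
by move=> /IH -> ; rewrite mxE => /fQ.
Qed.

(** Some [s0] has positive mass. Since [nu] is also stationary for every power of the chain, [nu s]
    contains the positive term that comes from [s0] along a path to [s]. *)
Lemma stationary_gt0 (nu : S -> R) :
  is_stationary Q nu -> forall s, 0 < nu s.
Proof.
case=> nu0 nu1 nuQ s.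
pose v : 'rV[R]_#|S| := \row_i nu (enum_val i).
have vM k : v *m M ^+ k = v.
  elim: k => [|k IH]; first by rewrite expr0 mulmx1.
  rewrite exprSr mulmxA IH; apply/rowP => j; rewrite !mxE -[RHS]nuQ -[RHS]sum_enum_val.
  by apply: eq_bigr => i _; rewrite !mxE.
have [s0 s0_gt0] : exists s0, 0 < nu s0.
  apply/existsP; apply: contraT => /existsPn H.
  have : \sum_s nu s <= 0 by apply: sumr_le0 => t _; rewrite leNgt.
  by rewrite nu1 ler10.
have [k] := Qirr s0 s; rewrite /chain_step -/M => Mp.
have /rowP/(_ (enum_rank s)) := vM k.
rewrite !mxE enum_rankK => <-; rewrite (bigD1 (enum_rank s0)) //=.
rewrite ltr_pwDl //; first by rewrite mxE enum_rankK mulr_gt0.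
by apply: sumr_ge0 => i _; rewrite mulr_ge0 // mxE.
Qed.

End Chains.

(** * The span of the columns as the image of the matrix *)

Lemma sum_columns (R : realType) (n d : nat) (Psi : 'M[R]_(n, d)) (z : 'cV[R]_d) :
  \sum_j z j 0 *: (columns Psi)`_j = Psi *m z.
Proof.
apply/colP => i; rewrite summxE mxE; apply: eq_bigr => j _.
by rewrite -tnth_nth tnth_mktuple !mxE mulrC.
Qed.

Lemma span_columnsP (R : realType) (n d : nat) (Psi : 'M[R]_(n, d)) x :
  reflect (exists z : 'cV[R]_d, x = Psi *m z) (x \in <<columns Psi>>%VS).
Proof.
apply: (iffP idP) => [/coord_span -> | [z ->]].
  exists (\col_j coord (columns Psi) j x); rewrite -sum_columns.
  by apply: eq_bigr => j _; rewrite mxE.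
rewrite -sum_columns; apply: memv_suml => j _; apply: memvZ; apply: memv_span.
by rewrite -tnth_nth mem_tnth.
Qed.

Lemma free_columns_inj (R : realType) (n d : nat) (Psi : 'M[R]_(n, d)) :
  free (columns Psi) -> forall z : 'cV[R]_d, Psi *m z = 0 -> z = 0.
Proof.
move=> /freeP H z; rewrite -sum_columns => /(H (fun j => z j 0)) z0.
by apply/colP => j; rewrite z0 mxE.
Qed.

(** * The chain on state-action pairs *)

(** The diagonal of [sa_weight]: [sa_weight nu p] converts to [diag_mx (weight_row nu p)], the shape
    in which the results on forms apply. *)
Definition weight_row (R : realType) (S A : finType) (nu : S -> R)
    (p : S -> A -> R) : 'rV[R]_#|{: S * A}| :=
  \row_i let: (s, a) := (enum_val i : S * A) in nu s * p s a.

Section StateAction.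
Variables (R : realType) (S A : finType) (Pk : S -> A -> S -> R).
Variables (pi : S -> A -> R) (nu : S -> R).
Hypothesis hPk : is_kernel Pk.
Hypothesis hpi : is_policy pi.
Hypothesis hnu : is_stationary (state_chain Pk pi) nu.

Let P := sa_transition Pk pi.
Let weight := @weight_row R S A nu.

Lemma sum_state_action (F : S -> A -> R) :
  \sum_(i < #|{: S * A}|) (let: (s, a) := (enum_val i : S * A) in F s a) =
  \sum_s \sum_a F s a.
Proof.
rewrite pair_bigA -[RHS]sum_enum_val.
by apply: eq_bigr => i _; case: (enum_val i).
Qed.

Lemma sum_weight (p : S -> A -> R) : (forall s, \sum_a p s a = 1) ->
  \sum_i weight p 0 i = 1.
Proof.
move=> p1; case: hnu => _ <- _.
under eq_bigr do rewrite mxE; rewrite sum_state_action.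
by apply: eq_bigr => s _; rewrite -mulr_sumr p1 mulr1.
Qed.

Lemma weight_ge0 (p : S -> A -> R) : (forall s a, 0 <= p s a) ->
  forall i, 0 <= weight p 0 i.
Proof.
case: hnu => nu0 _ _ p0 i; rewrite mxE.
by case: (enum_val i) => s a; rewrite mulr_ge0.
Qed.

Lemma sa_transition_ge0 i j : 0 <= P i j.
Proof.
case: hPk hpi => Pk0 _ [pi0 _]; rewrite mxE.
by case: (enum_val i) (enum_val j) => s a [s' a']; rewrite mulr_ge0.
Qed.

Lemma sa_transition_sum1 i : \sum_j P i j = 1.
Proof.
case: hPk hpi => _ Pk1 [_ pi1]; under eq_bigr do rewrite mxE.
case: (enum_val i) => s a; rewrite sum_state_action -(Pk1 s a).
by apply: eq_bigr => s' _; rewrite -mulr_sumr pi1 mulr1.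
Qed.

Lemma sa_stationary j : \sum_i weight pi 0 i * P i j = weight pi 0 j.
Proof.
case: hnu => _ _ nuQ.
rewrite mxE; under eq_bigr do rewrite !mxE.
case: (enum_val j) => s' a'.
transitivity (\sum_s \sum_a nu s * pi s a * (Pk s a s' * pi s' a')).
  by rewrite -sum_state_action; apply: eq_bigr => i _; case: (enum_val i).
rewrite -(nuQ s') mulr_suml; apply: eq_bigr => s _.
by rewrite mulr_sumr mulr_suml; apply: eq_bigr => a _; ring.
Qed.

Lemma state_chain_ge0 s s' : 0 <= state_chain Pk pi s s'.
Proof.
by case: hPk hpi => Pk0 _ [pi0 _]; apply: sumr_ge0 => a _; rewrite mulr_ge0.
Qed.

(** Both sides carry the factor [pi s' a'], so zeros of the policy do no harm; what remains is
    [Pk s a s' <= 1] and [m <= nu s']. *)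
Lemma sa_transition_le_weight m : 0 <= m -> (forall s, m <= nu s) ->
  forall i j, m * P i j <= weight pi 0 j.
Proof.
case: hPk hpi => Pk0 Pk1 [pi0 _] m0 mnu i j; rewrite !mxE.
case: (enum_val i) (enum_val j) => s a [s' a'].
rewrite mulrA ler_wpM2r // -[leRHS]mulr1 ler_pM //.
by rewrite -(Pk1 s a) (bigD1 s') //= lerDl sumr_ge0.
Qed.

(* A vector that is invariant along transitions agrees, on the support of
   [pi s], with its [pi s]-mean, and that mean is invariant along the state
   chain. *)
Lemma dirichlet_null_const (x : 'cV[R]_#|{: S * A}|) :
  irreducible_chain (state_chain Pk pi) ->
  (forall i j, 0 < weight pi 0 i * P i j -> x i 0 = x j 0) ->
  exists k, forall s a, 0 < pi s a -> sa_entry x s a = k.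
Proof.
move=> irr xP.
have nu_gt0 := stationary_gt0 state_chain_ge0 irr hnu.
case: (hPk) (hpi) (hnu) => Pk0 Pk1 [pi0 pi1] [nu0 nu1 nuQ].
have pos_act s (F : A -> R) : 0 < \sum_a pi s a * F a -> exists2 a, 0 < pi s a & 0 < F a.
  move=> H; have [a /andP[]] : exists a, (0 < pi s a) && (0 < F a); last by exists a.
  apply/existsP; apply: contraTT H => /existsPn H; rewrite -leNgt.
  apply: sumr_le0 => a _; have := H a; rewrite negb_and -!leNgt => /orP[] H'.
    suff -> : pi s a = 0 by rewrite mul0r.
    by apply/eqP; rewrite eq_le H' pi0.
  by rewrite mulr_ge0_le0.
have step s a s' a' : 0 < pi s a -> 0 < Pk s a s' -> 0 < pi s' a' ->
    sa_entry x s a = sa_entry x s' a'.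
  by move=> h1 h2 h3; apply: xP; rewrite !mxE !enum_rankK !mulr_gt0.
pose v s := \sum_a pi s a * sa_entry x s a.
have xv s a : 0 < pi s a -> sa_entry x s a = v s.
  move=> sa.
  (* As [nu s] is positive, stationarity provides a predecessor of [s]. All supported actions at [s]
     are reached from one and the same pair [(s0, a0)], hence share its value. *)
  have [s0 s0s] : exists s0, 0 < state_chain Pk pi s0 s.
    apply/existsP; apply: contraTT (nu_gt0 s) => /existsPn H.
    rewrite -leNgt -nuQ; apply: sumr_le0 => t _.
    by rewrite mulr_ge0_le0 // leNgt.
  have [a0 h1 h2] := pos_act _ _ s0s.
  rewrite -[LHS]mul1r -(pi1 s) mulr_suml; apply: eq_bigr => b _.
  have [->|pib] := eqVneq (pi s b) 0; first by rewrite !mul0r.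
  have {}pib : 0 < pi s b by rewrite lt_def pib pi0.
  by rewrite -(step _ _ _ _ h1 h2 sa) (step _ _ _ _ h1 h2 pib).
have vQ s s' : 0 < state_chain Pk pi s s' -> v s = v s'.
  move=> /pos_act[a h1 h2]; rewrite -(xv _ _ h1).
  have [a' h3 _] : exists2 a', 0 < pi s' a' & 0 < 1 :> R.
    by apply: pos_act; under eq_bigr do rewrite mulr1; rewrite pi1 ltr01.
  by rewrite (step _ _ _ _ h1 h2 h3) (xv _ _ h3).
have vc := irreducible_invariant state_chain_ge0 irr vQ.
have [s0 _|S0] := pickP (fun _ : S => true).
  by exists (v s0) => s a /xv ->.
by exists 0 => s; have := S0 s.
Qed.

End StateAction.

(** * The perturbed policy and the smallest stationary probability *)

Section Perturbed.
Variables (R : realType) (S A : finType) (pi : S -> A -> R) (pmin : R).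
Hypothesis hpi : is_policy pi.
Hypothesis pmin0 : 0 < pmin.
Hypothesis al0 : 0 < alpha pi pmin.

Let As := main_actions pi pmin.
Let missing s : R := #|A|%:R - #|As s|%:R.

Lemma min_main_actions_le s : (min_main_actions pi pmin <= #|As s|)%N.
Proof.
rewrite /min_main_actions; have := mem_index_enum s.
elim: (index_enum S) => [//|t r IH]; rewrite inE big_cons geq_min.
by case/predU1P => [->|/IH ->]; rewrite ?leqnn ?orbT.
Qed.

Lemma min_main_actions_le_card : (min_main_actions pi pmin <= #|A|)%N.
Proof.
apply: (big_ind (fun k => k <= #|A|)%N) => // [k l kA lA | s _].
  by rewrite geq_min kA.
exact: max_card.
Qed.

Let missing_ge0 s : 0 <= missing s.
Proof. by rewrite subr_ge0 ler_nat max_card. Qed.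

(** The right side is the mass that the perturbed policy leaves to the main actions at [s]; [alpha]
    bounds it uniformly in [s]. *)
Let alpha_le s : alpha pi pmin <= 1 - missing s * pmin.
Proof.
rewrite lerD2l lerN2 ler_wpM2r ?(ltW pmin0) // lerD2l lerN2 ler_nat.
exact: min_main_actions_le.
Qed.

Let sum_compl s (F : A -> R) :
  \sum_a F a = \sum_(a in As s) F a + \sum_(a in ~: As s) F a.
Proof.
rewrite (bigID (mem (As s))) /=; congr (_ + _).
by apply: eq_bigl => a; rewrite finset.in_setC.
Qed.

Let sum_const_compl s (k : R) : \sum_(a in ~: As s) k = missing s * k.
Proof.
by rewrite sumr_const cardsCs finset.setCK -mulr_natl natrB ?max_card.
Qed.

Let main_mass_le1 s : \sum_(a in As s) pi s a <= 1.
Proof.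
case: hpi => pi0 pi1; rewrite -(pi1 s) (sum_compl s) lerDl.
by apply: sumr_ge0.
Qed.

(** The other actions carry at most [missing s * pmin <= 1 - alpha pi pmin < 1]. This justifies the
    division in [perturbed]. *)
Let main_mass_gt0 s : 0 < \sum_(a in As s) pi s a.
Proof.
case: hpi => pi0 pi1.
have : \sum_(a in ~: As s) pi s a <= missing s * pmin.
  rewrite -sum_const_compl; apply: ler_sum => a; rewrite !inE -leNgt => h.
  by rewrite (le_trans h) // ler_pdivrMr // ler_peMr ?ler1n // ltW.
have := alpha_le s; have := pi1 s; rewrite (sum_compl s); move: al0; lra.
Qed.

Lemma perturbed_sum1 s : \sum_a perturbed pi pmin s a = 1.
Proof.
rewrite (sum_compl s).
rewrite (eq_bigr (fun a => pi s a * ((1 - missing s * pmin) / \sum_(b in As s) pi s b))).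
  rewrite -mulr_suml mulrCA mulfV ?gt_eqF // mulr1.
  rewrite (eq_bigr (fun=> pmin)) ?sum_const_compl ?subrK // => a.
  by rewrite /perturbed -/As inE => /negPf ->.
by move=> a aAs; rewrite /perturbed aAs.
Qed.

(** This makes [E = Dt - al D] nonnegative. On main actions, [pi] is multiplied by at least [alpha],
    as their total mass is at most 1; elsewhere [pi s a <= pmin / 2] and [alpha <= 1]. *)
Lemma alpha_le_perturbed s a : alpha pi pmin * pi s a <= perturbed pi pmin s a.
Proof.
case: (hpi) => pi0 pi1; rewrite /perturbed -/(As s).
case: ifPn => [aAs|].
  rewrite mulrC ler_wpM2l // ler_pdivlMr // (le_trans _ (alpha_le s)) //.
  by rewrite ler_piMr // ltW.
rewrite inE -leNgt => h.
have al1 : alpha pi pmin <= 1.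
  by apply: le_trans (alpha_le s) _; rewrite gerBl mulr_ge0 // ltW.
have := ler_wpM2r (pi0 s a) al1; move: h pmin0; lra.
Qed.

(** Hence [Dt] is positive definite, even where [pi] vanishes; the uniqueness of [theta] relies on
    it. *)
Lemma perturbed_gt0 s a : 0 < perturbed pi pmin s a.
Proof.
have [|/negPf aAs] := boolP (a \in As s); last by rewrite /perturbed aAs.
rewrite inE => h; apply: lt_le_trans (alpha_le_perturbed s a).
by rewrite mulr_gt0 // (lt_trans _ h) // divr_gt0.
Qed.

End Perturbed.

(** Two distinct states have total mass at most 1, so the lighter one has at most [1 / 2]. With a
    gap of at most 2, the product of gap and minimum is at most 1. *)
Lemma min_prob_bounds (R : realType) (S : finType) (nu : S -> R) :
  (forall s, 0 < nu s) -> \sum_s nu s = 1 -> (2 <= #|S|)%N ->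
  0 < min_prob nu <= 1 / 2.
Proof.
move=> nu0 nu1 /card_gt1P[s [t [_ _ st]]].
have mle u : min_prob nu <= nu u by apply: bigmin_le.
apply/andP; split; first by apply: lt_bigmin => //; exact: ltr01.
have : nu s + nu t <= 1.
  rewrite -nu1 (bigD1 s) //= lerD2l (bigD1 t) /=; last by rewrite eq_sym.
  by rewrite lerDl sumr_ge0 // => u _; rewrite ltW.
have := mle s; have := mle t; lra.
Qed.

Lemma innerC (R : realType) (n : nat) (x y : 'cV[R]_n) : inner x y = inner y x.
Proof. by rewrite /inner !mxE; apply: eq_bigr => i _; rewrite !mxE mulrC. Qed.

(** * The projected equation and the monotonicity of its operator *)

Section Td.
Variables (R : realType) (n d : nat) (Psi : 'M[R]_(n, d)).
Variables (w : 'rV[R]_n) (P : 'M[R]_n) (k : R).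
Hypothesis w_gt0 : forall i, 0 < w 0 i.
Hypothesis k0 : 0 < k.
Hypothesis Psi_inj : forall z : 'cV[R]_d, Psi *m z = 0 -> z = 0.
Hypothesis form_ge : forall z : 'cV[R]_d,
  k * (\sum_i w 0 i * (Psi *m z) i 0 ^+ 2) <=
  ((Psi *m z)^T *m diag_mx w *m (1%:M - P) *m (Psi *m z)) 0 0.

(** The equation is linear with square matrix [K]. If [K *m z = 0], the form vanishes at [Psi *m z],
    so coercivity and positive weights give [Psi *m z = 0], and then [z = 0]. Thus [K] is
    invertible. *)
Lemma td_solution_unique (b : 'cV[R]_n) :
  exists! z : 'cV[R]_d, Psi^T *m diag_mx w *m Psi *m z =
    Psi^T *m diag_mx w *m P *m Psi *m z + Psi^T *m diag_mx w *m b.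
Proof.
pose K := Psi^T *m diag_mx w *m (1%:M - P) *m Psi.
have KE z : K *m z = Psi^T *m diag_mx w *m Psi *m z
    - Psi^T *m diag_mx w *m P *m Psi *m z.
  by rewrite /K mulmxBr mulmx1 !mulmxBl.
have Kinj (z : 'cV[R]_d) : K *m z = 0 -> z = 0.
  move=> Kz; apply: Psi_inj; apply/colP => i; rewrite [RHS]mxE.
  have /eqP Nz : \sum_i w 0 i * (Psi *m z) i 0 ^+ 2 == 0.
    rewrite eq_le sumr_ge0 => [|l _]; last by rewrite mulr_ge0 ?sqr_ge0 // ltW.
    have := form_ge z; rewrite trmx_mul.
    have -> : z^T *m Psi^T *m diag_mx w *m (1%:M - P) *m (Psi *m z) =
      z^T *m (K *m z) by rewrite /K !mulmxA.
    by rewrite Kz mulmx0 mxE pmulr_rle0 // => ->.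
  have /eqP := psumr_eq0P (fun l _ => mulr_ge0 (ltW (w_gt0 l)) (sqr_ge0 _)) Nz (i := i) isT.
  by rewrite mulf_eq0 gt_eqF // sqrf_eq0 => /eqP.
have Kunit : K \in unitmx.
  (* Row freeness of the transpose is injectivity of [K] on columns. *)
  rewrite -unitmx_tr -row_free_unit; apply: inj_row_free => v vK.
  apply: trmx_inj; rewrite trmx0; apply: Kinj.
  by apply: trmx_inj; rewrite trmx_mul trmxK vK trmx0.
exists (invmx K *m (Psi^T *m diag_mx w *m b)); split.
  by apply/eqP; rewrite addrC -subr_eq -KE mulKVmx.
by move=> z /eqP; rewrite addrC -subr_eq -KE => /eqP <-; rewrite mulKmx.
Qed.

(** The operator is affine in its parameter: the terms in [c] and [rho] cancel and only the linear
    part is left. *)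
Lemma inner_td_operatorB (c : 'cV[R]_n) (z z' : 'cV[R]_d) (rho : R) :
  inner (td_operator Psi (diag_mx w) P c z rho -
         td_operator Psi (diag_mx w) P c z' rho) (z - z') =
  ((Psi *m (z - z'))^T *m diag_mx w *m (1%:M - P) *m (Psi *m (z - z'))) 0 0.
Proof.
rewrite /td_operator -mulmxBr.
have -> : Psi *m z - P *m Psi *m z - c + rho *: const_mx 1 -
    (Psi *m z' - P *m Psi *m z' - c + rho *: const_mx 1) =
    (1%:M - P) *m (Psi *m (z - z')).
  rewrite mulmxBl mul1mx !mulmxBr -!mulmxA.
  move: (Psi *m z) (Psi *m z') => u u'; move: (P *m u) (P *m u') => v v'.
  by apply/colP => i; rewrite !mxE; ring.
by rewrite innerC /inner trmx_mul !mulmxA.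
Qed.
End Td.

(** * Positivity of the gap, then the numerical constants and the conclusions *)

Theorem lemma9 (R : realType) (S A : finType) (Pk : S -> A -> S -> R)
    (c : 'cV[R]_#|{: S * A}|) (pi : S -> A -> R) (nu : S -> R)
    (d : nat) (Psi : 'M[R]_(#|{: S * A}|, d))
    (hPk : is_kernel Pk) (hergodic : ergodic_mdp Pk) (hpi : is_policy pi)
    (hnu : is_stationary (state_chain Pk pi) nu)
    (hfree : free (columns Psi))
    (hno1 : ~ exists2 x : 'cV[R]_#|{: S * A}|, x \in <<columns Psi>>%VS &
              forall s a, 0 < pi s a -> sa_entry x s a = 1) :
  let P := sa_transition Pk pi in
  let D := sa_weight nu pi in
  let rho_star := average_cost nu pi c in
  let gap := inf_form <<columns Psi>>%VS D P in
  (0 < gap)%E /\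
  ((2 <= #|S|)%N ->
   forall beta : R, gap = (1 - beta)%:E ->
   forall pmin : R, 0 < pmin -> pmin < 1 ->
   let Amin := min_main_actions pi pmin in
   Amin <> #|A| ->
   pmin <= (1 - beta) * min_prob nu /
           ((#|A|%:R - Amin%:R) * (8 + (1 - beta) * min_prob nu)) ->
   let Dt := sa_weight nu (perturbed pi pmin) in
   let al := alpha pi pmin in
   let bound := Num.min (27 * al * (1 - beta) / 32) ((1 - al * (1 - beta)) / 8) in
   let g := td_operator Psi Dt P c in
   [/\ (bound%:E <= inf_form <<columns Psi>>%VS Dt P)%E,
       8 / 9 <= al,
       exists! theta : 'cV[R]_d,
         Psi^T *m Dt *m Psi *m theta =
         Psi^T *m Dt *m P *m Psi *m theta
         + Psi^T *m Dt *m (c - rho_star *: const_mx 1)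
     & forall (theta theta' : 'cV[R]_d) (rho : R),
         bound * wnorm Dt (Psi *m theta - Psi *m theta') ^+ 2
         <= inner (g theta rho - g theta' rho) (theta - theta')]).
Proof.
set V := <<columns Psi>>%VS; move=> P D rho_star gap.
have [irr _] := hergodic pi hpi.
have nu_gt0 := stationary_gt0 (state_chain_ge0 hPk hpi) irr hnu.
have P0 := sa_transition_ge0 hPk hpi; have P1 := sa_transition_sum1 hPk hpi.
have pi0 : forall s a, 0 <= pi s a by case: hpi.
have mu0 := weight_ge0 hnu pi0; have muP := sa_stationary hnu.
set mu := weight_row nu pi in mu0 muP.
have form0 := dirichlet_ge0 P0 P1 mu0 muP.
have gap_gt0 : (0 < gap)%E.
  have [z xP i|k k0 Hk] := dirichlet_coercive P0 P1 mu0 muP (Psi := Psi).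
    have [k xk] := dirichlet_null_const hPk hpi hnu irr xP.
    have k0 : k = 0.
      (* Dividing by a nonzero [k] would give the excluded vector, equal to 1 on the support of
         [pi]. *)
      apply/eqP; apply: contra_notT hno1 => k0.
      exists (k^-1 *: (Psi *m z)) => [|s a sa].
        by apply: memvZ; apply/span_columnsP; exists z.
      by rewrite /sa_entry mxE -/(sa_entry _ _ _) xk // mulVf.
    rewrite mxE -(enum_valK i); case: (enum_val i) => s a.
    rewrite enum_rankK pmulr_rgt0 // => /xk; rewrite k0 /sa_entry => <-.
    by [].
  apply: (@lt_le_trans _ _ k%:E); first by rewrite lte_fin.
  apply: inf_form_ge => // _ /span_columnsP[z ->]; exact: Hk.
split => // S2 beta gapE pmin pmin0 pmin1 Amin AminA pmin_le Dt al bound g.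
set gam := 1 - beta in gapE pmin_le bound *.
have gam0 : 0 < gam by rewrite -lte_fin -gapE.
have hg : forall x, x \in V -> gam * (\sum_i mu 0 i * x i 0 ^+ 2) <=
    (x^T *m diag_mx mu *m (1%:M - P) *m x) 0 0.
  by apply: inf_form_geP => //; rewrite -gapE.
(* A finite infimum is over a nonempty set. *)
have gam2 : gam <= 2.
  rewrite leNgt; apply/negP => gam_gt2.
  have : ((gam + 1)%:E <= gap)%E.
    apply/ereal_infP => _ [x [Vx Nx] <-]; rewrite lee_fin.
    have := hg x Vx; have := dirichlet_le P0 P1 mu0 muP x.
    rewrite -sqr_wnorm_diag // Nx expr1n; lra.
  by rewrite gapE lee_fin; lra.
have [_ nu1 _] := hnu.
have /andP[] := min_prob_bounds nu_gt0 nu1 S2.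
set m := min_prob nu in pmin_le * => m0 m2.
have A0 : 0 < #|A|%:R - Amin%:R :> R.
  rewrite subr_gt0 ltr_nat ltn_neqAle min_main_actions_le_card andbT.
  exact/eqP.
have gm0 : 0 < gam * m by rewrite mulr_gt0.
(* With [n = #|A| - Amin] one has [1 - al = n * pmin]; the bound on [pmin] reads
   [n * pmin * (8 + gam * m) <= gam * m], which rearranges to this. *)
have al8 : 8 * (1 - al) <= m * al * gam.
  move: pmin_le; rewrite ler_pdivlMr; last by rewrite mulr_gt0 ?A0 // addr_gt0.
  rewrite /al /alpha -/Amin.
  set n := _ - Amin%:R; nra.
have gm1 : gam * m <= 1.
  by have := ler_pM (ltW gam0) (ltW m0) gam2 m2; lra.
have al1 : al <= 1 by rewrite /al /alpha gerBl mulr_ge0 // ltW.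
(* Two rounds: [al <= 1] gives [8 * (1 - al) <= gam * m <= 1], so [al] is positive; then
   [al * (gam * m) <= al] gives [8 * (1 - al) <= al], that is [8 / 9 <= al]. *)
have al0 : 0 < al.
  have : 0 <= (1 - al) * (gam * m) by rewrite mulr_ge0 ?subr_ge0 // ltW.
  by lra.
have al89 : 8 / 9 <= al by have := ler_wpM2l (ltW al0) gm1; lra.
pose w := weight_row nu (perturbed pi pmin).
have w_gt0 i : 0 < w 0 i.
  by rewrite mxE; case: (enum_val i) => s a; rewrite mulr_gt0 ?perturbed_gt0.
have muw i : al * mu 0 i <= w 0 i.
  rewrite !mxE; case: (enum_val i) => s a.
  by rewrite mulrCA ler_wpM2l ?(ltW (nu_gt0 s)) // alpha_le_perturbed.
(* Uniqueness of [theta] rests on this constant instead of [bound], which can be nonpositive. *)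
pose k := Num.min (15 / 16 * gam) 2^-1.
have k0 : 0 < k by rewrite lt_min invr_gt0 ltr0n mulr_gt0 // divr_gt0.
(* Entry by entry: [27 / 32 <= 15 / 16] with [al <= 1], and
   [(1 - al * gam) / 8 <= 1 / 8 <= 1 / 2]. *)
have bound_le : bound <= k.
  have agam0 : 0 <= al * gam by rewrite mulr_ge0 // ltW.
  have agam : al * gam <= gam by rewrite ler_piMl // ltW.
  by rewrite le_min !ge_min; apply/andP; split; apply/orP; [left|right]; lra.
have key x : x \in V -> k * (\sum_i w 0 i * x i 0 ^+ 2) <=
    (x^T *m diag_mx w *m (1%:M - P) *m x) 0 0.
  move=> Vx.
  have mle s : m <= nu s by apply: bigmin_le.
  have := perturbed_form_ge P0 P1 mu0 m0 (ltW al0)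
    (sa_transition_le_weight hPk hpi (ltW m0) mle) muw
    (sum_weight hnu (proj2 hpi)) (sum_weight hnu (perturbed_sum1 hpi pmin0 al0))
    al8 (hg x Vx).
  apply: le_trans.
  set X := al * _; set Y := \sum_i _.
  have X0 : 0 <= X.
    by rewrite mulr_ge0 ?(ltW al0) // sumr_ge0 // => i _; rewrite mulr_ge0 ?sqr_ge0.
  have XY : 0 <= Y - X.
    rewrite subr_ge0 /X mulr_sumr; apply: ler_sum => i _.
    by rewrite mulrA ler_wpM2r ?sqr_ge0.
  have k1 : k <= 15 / 16 * gam by rewrite ge_min lexx.
  have k2 : k <= 2^-1 by rewrite ge_min lexx orbT.
  have := ler_wpM2r X0 k1; have := ler_wpM2r XY k2; lra.
have w0 i : 0 <= w 0 i by rewrite ltW.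
have boundkey x : x \in V -> bound * (\sum_i w 0 i * x i 0 ^+ 2) <=
    (x^T *m diag_mx w *m (1%:M - P) *m x) 0 0.
  move=> Vx; apply: le_trans (key x Vx); apply: ler_wpM2r => //.
  by apply: sumr_ge0 => i _; rewrite mulr_ge0 ?sqr_ge0.
have memV z : Psi *m z \in V by apply/span_columnsP; exists z.
split => //.
- exact: inf_form_ge.
- apply: (td_solution_unique w_gt0 k0 (free_columns_inj hfree)) => z.
  exact: key.
- move=> z z' rho; rewrite inner_td_operatorB -mulmxBr.
  by rewrite sqr_wnorm_diag //; apply: boundkey.
Qed.
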